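(* Let $\lambda=(\lambda_1,2^\beta,1^\gamma)$ be a hook+column partition and let $r\ge 2$ be an integer. Assume that $\lambda_1-r-\gamma=2\delta$ for some non-negative integer $\delta$. Consider the following brick tiling of $\lambda$: (1) the first row is made up of one $(1\times r)$-tile, followed by $\delta$ tiles of shape $(1\times 2)$, followed by $\gamma$ tiles of shape $(1\times 1)$; (2) each of the remaining rows forms a single tile. Then the flip involution with offset $r$ corresponds to tiled transposition: the tiled-transpose of $\lambda$ with respect to this brick tiling is $\mathrm{flip}(r;\lambda)$.
   Context: A hook+column partition is a partition of the form $(\alpha,2^\beta,1^\gamma)$, where $\alpha$ is the first part (possibly equal to $1$ or $2$), followed by $\beta$ parts equal to $2$ and $\gamma$ parts equal to $1$. Flip involution: for an integer $r\ge2$ and a hook+column partition $\lambda=(r+2\delta+\gamma,2^\beta,1^\gamma)$ with $\delta\ge0$ an integer, $\mathrm{flip}(r;\lambda)=(r+2\beta+\gamma,2^\delta,1^\gamma)$. A tiling of a partition is a collection of non-overlapping rectangles (tiles) of shape $(h\times w)$ (height $h$, width $w$) covering its Young diagram; it is a brick tiling if every tile has height $1$. A brick tiling of $\lambda$ gives a tableau $T_\lambda$: a row of $\lambda$ tiled, from left to right, into tiles $(1\times t_1),(1\times t_2),\dots,(1\times t_k)$ is collapsed to the row $t_1,t_2,\dots,t_k$ of $T_\lambda$; doing this for each row gives $T_\lambda$ (whose shape is in general a composition). If the shape of $T_\lambda$ is a partition, the tiled-transpose of $\lambda$ is the brick-tiled partition $\mu$ whose tableau $T_\mu$ is the transpose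 of $T_\lambda$. *)

(* Defs.v *)
From mathcomp Require Import all_boot.

Set Implicit Arguments.
Unset Strict Implicit.
Unset Printing Implicit Defensive.

Definition is_partition (l : seq nat) : bool := sorted geq l && all (leq 1) l.

(* The sequence (alpha, 2^beta, 1^gamma); it is a partition iff alpha >= 1 and,
   when beta > 0, alpha >= 2. *)
Definition hook_column (alpha beta gamma : nat) : seq nat :=
  alpha :: nseq beta 2 ++ nseq gamma 1.

(* On l = hook_column alpha beta gamma, the exponents beta and gamma are read
   off from the tail of l, and delta solves alpha = r + 2 * delta + gamma.
   The value is meaningful only when such a delta exists; see flipE. *)
Definition flip (r : nat) (l : seq nat) : seq nat :=
  let beta := count_mem 2 (behead l) in
  let gamma := count_mem 1 (behead l) in
  let delta := (head 0 l - r - gamma)./2 in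
  hook_column (r + 2 * beta + gamma) delta gamma.

Lemma flipE r beta gamma delta :
  flip r (hook_column (r + 2 * delta + gamma) beta gamma)
  = hook_column (r + 2 * beta + gamma) delta gamma.
Proof.
rewrite /flip /= !count_cat !count_nseq /= !mul1n !mul0n addn0 add0n.
by rewrite -(addnA r (2 * delta)) addKn addnK !mul2n doubleK.
Qed.

(* Boxes are pairs (row, column), numbered from 0, with rows going downwards
   and columns from left to right. *)
Definition in_diagram (l : seq nat) (b : nat * nat) : bool :=
  b.2 < nth 0 l b.1.

(* A rectangle, located by its top-left box (trow, tcol). *)
Record tile := Tile { trow : nat; tcol : nat; theight : nat; twidth : nat }.

Definition tshape (t : tile) : nat * nat := (theight t, twidth t).

Definition in_tile (t : tile) (b : nat * nat) : bool :=
  (trow t <= b.1 < trow t + theight t) && (tcol t <= b.2 < tcol t + twidth t).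

(* A collection of tiles is a list whose order is irrelevant: the functions
   below sort the tiles of each row. Non-overlapping means that no box lies in
   two tiles of the list, so a repeated tile counts as an overlap. *)
Definition is_tiling (l : seq nat) (s : seq tile) : Prop :=
  [/\ all (fun t => (0 < theight t) && (0 < twidth t)) s,
      forall b, count (in_tile^~ b) s <= 1
    & forall b, has (in_tile^~ b) s = in_diagram l b].

Definition is_brick_tiling (l : seq nat) (s : seq tile) : Prop :=
  is_tiling l s /\ all (fun t => theight t == 1) s.

(* For brick tilings: the tiles of row i, from left to right. *)
Definition row_tiles (s : seq tile) (i : nat) : seq tile :=
  sort (fun t u => tcol t <= tcol u) [seq t <- s | trow t == i].

Definition tableau (l : seq nat) (s : seq tile) : seq (seq nat) :=
  mkseq (fun i => [seq twidth t | t <- row_tiles s i]) (size l).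

(* Row j of the transpose is column j of T, read from top to bottom. This is
   the usual transpose when the shape of T is a partition. *)
Definition transpose (T : seq (seq nat)) : seq (seq nat) :=
  mkseq (fun j => [seq nth 0 row j | row <- T & j < size row])
        (size (head [::] T)).

(* The partition m, brick-tiled by s', is the tiled-transpose of l brick-tiled
   by s. *)
Definition is_tiled_transpose (l : seq nat) (s : seq tile)
    (m : seq nat) (s' : seq tile) : Prop :=
  [/\ is_partition l /\ is_brick_tiling l s,
      is_partition (shape (tableau l s)),
      is_partition m /\ is_brick_tiling m s'
    & tableau m s' = transpose (tableau l s)].

Definition is_flip_tiling (r delta gamma : nat) (l : seq nat) (s : seq tile)
    : Prop :=
  [/\ is_brick_tiling l s,
      [seq tshape t | t <- row_tiles s 0]
        = (1, r) :: nseq delta (1, 2) ++ nseq gamma (1, 1)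
    & forall i, 0 < i < size l -> size (row_tiles s i) = 1].

(* Main.v *)
Require Import Defs.
From HB Require Import structures.
From mathcomp Require Import all_boot.
From mathcomp Require Import zify.

Set Implicit Arguments.
Unset Strict Implicit.
Unset Printing Implicit Defensive.

(** Brick tilings of a diagram and arrays of positive integers are two views of
    the same thing. In one direction, the widths of the tiles in a row add up
    to the length of that row, so a diagram is recovered from the tableau of
    any of its brick tilings by summing rows ([sumn_tableau]). In the other,
    laying tiles side by side realizes any array with positive entries as the
    tableau of a brick tiling of its row sums ([bricks_tiling],
    [tableau_bricks]).

    It follows that the prescribed tiling of (r + 2 delta + gamma, 2^beta,
    1^gamma) exists and that its tableau is forced. The tableau has the shape
    of a hook, with corner r, arm (2^delta, 1^gamma) and leg (2^beta, 1^gamma).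
    Transposing a hook exchanges arm and leg ([transpose_hook_tableau]), that
    is, delta and beta. The row sums of the transposed tableau are
    (r + 2 beta + gamma, 2^delta, 1^gamma), which is the flip; the flip is
    therefore the only partition that can carry the transposed tableau, and it
    does carry it. *)

(** * Tiles as an equality type *)

Definition tile_tuple (t : tile) := (trow t, tcol t, theight t, twidth t).

Definition tuple_tile (x : nat * nat * nat * nat) :=
  let: (i, j, h, w) := x in Tile i j h w.

Lemma tile_tupleK : cancel tile_tuple tuple_tile.
Proof. by case. Qed.

HB.instance Definition _ := Equality.copy tile (can_type tile_tupleK).

(** * Row lengths are sums of tile widths *)

Lemma in_brick t i c : theight t = 1 ->
  in_tile t (i, c) = (trow t == i) && (tcol t <= c < tcol t + twidth t).
Proof. by move=> ht; rewrite /in_tile /= ht addn1 ltnS -eqn_leq. Qed.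

Lemma sum_interval N a w : a + w <= N -> \sum_(c < N) (a <= c < a + w) = w.
Proof.
move=> le_awN; rewrite -(big_mkord xpredT (fun c => (a <= c < a + w) : nat)).
rewrite (big_cat_nat (n := a + w)) //= (big_cat_nat (n := a)) ?leq_addr //=.
rewrite big_nat big1 => [|c /andP[_ lt_ca]]; last by lia.
rewrite [X in _ + X]big_nat [X in _ + X]big1 => [|c /andP[le_c _]];
  last by lia.
rewrite big_nat (eq_bigr (fun=> 1)) => [|c ->] //.
by rewrite -big_nat sum_nat_const_nat addKn muln1 add0n addn0.
Qed.

(** Double counting of the pairs (box of row i, tile containing that box): every
    box lies in exactly one tile, and a brick of row i contains as many boxes
    of that row as its width, because it does not stick out of the diagram. *)
Lemma sumn_row_tiles l s i : is_brick_tiling l s ->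
  sumn [seq twidth t | t <- row_tiles s i] = nth 0 l i.
Proof.
case=> -[/allP pos_s disj_s cov_s] /allP brick_s.
rewrite sumnE big_map (perm_big [seq t <- s | trow t == i]) /=; last first.
  by rewrite perm_sort.
rewrite big_filter; set N := nth 0 l i.
transitivity (\sum_(t <- s) \sum_(c < N) in_tile t (i, val c)).
  rewrite big_mkcond; apply: eq_big_seq => t s_t.
  have ht : theight t = 1 by apply/eqP/brick_s.
  rewrite (eq_bigr (fun c : 'I_N =>
      (trow t == i) && (tcol t <= c < tcol t + twidth t) : nat)); last first.
    by move=> c _; rewrite in_brick.
  case: eqP => [ti | _]; last by rewrite big1.
  rewrite sum_interval //.
  (* The last box of the tile lies in row i of the diagram. *)
  have /andP[_ w_gt0] := pos_s t s_t.
  have: in_diagram l (i, (tcol t + twidth t).-1).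
    rewrite -cov_s; apply/hasP; exists t => //.
    by rewrite in_brick // ti eqxx; lia.
  by rewrite /in_diagram /= -/N; lia.
rewrite exchange_big /= -[RHS]card_ord -sum1_card.
apply: eq_bigr => c _.
have /= := cov_s (i, val c); rewrite /in_diagram /= -/N ltn_ord has_count.
move: (disj_s (i, val c)); rewrite -sum1_count [in X in _ -> X]big_mkcond /=.
rewrite [X in X <= 1]big_mkcond /=.
rewrite (eq_bigr (fun t => in_tile t (i, val c) : nat)); last first.
  by move=> t _; case: in_tile.
by lia.
Qed.

Lemma sumn_tableau l s : is_brick_tiling l s ->
  [seq sumn row | row <- tableau l s] = l.
Proof.
move=> bt; rewrite -map_comp -[RHS](mkseq_nth 0).
by apply: eq_map => i /=; apply: sumn_row_tiles.
Qed.

(** * Brick tilings with a prescribed tableau *)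

Fixpoint brick_row (i c : nat) (ws : seq nat) : seq tile :=
  if ws is w :: ws' then Tile i c 1 w :: brick_row i (c + w) ws' else [::].

Fixpoint bricks (i : nat) (T : seq (seq nat)) : seq tile :=
  if T is ws :: T' then brick_row i 0 ws ++ bricks i.+1 T' else [::].

Lemma all_brick_row (p : pred nat) i c ws :
  all (fun t => (trow t == i) && (theight t == 1) && p (twidth t))
      (brick_row i c ws) = all p ws.
Proof. by elim: ws c => //= w ws IH c; rewrite eqxx IH. Qed.

Lemma count_brick_row i c ws a b :
  count (in_tile^~ (a, b)) (brick_row i c ws)
  = ((i == a) && (c <= b < c + sumn ws) : nat).
Proof.
elim: ws c => [|w ws IH] c /=; first by lia.
by rewrite IH in_brick //=; lia.
Qed.

Lemma count_bricks i T a b :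
  count (in_tile^~ (a, b)) (bricks i T)
  = ((i <= a) && (b < sumn (nth [::] T (a - i))) : nat).
Proof.
elim: T i => [|ws T IH] i /=; first by rewrite nth_nil andbF.
rewrite count_cat IH count_brick_row.
have [lt_ia | lt_ai | <-] := ltngtP i a => //=.
  by rewrite -(subnSK lt_ia).
by rewrite subnn /= addn0.
Qed.

Lemma filter_bricks i T a :
  [seq t <- bricks i T | trow t == a]
  = if i <= a then brick_row a 0 (nth [::] T (a - i)) else [::].
Proof.
have filter_row j c ws : [seq t <- brick_row j c ws | trow t == a]
    = if j == a then brick_row j c ws else [::].
  by elim: ws c => [|w ws IH] c /=; rewrite ?IH; case: (j == a).
elim: T i => [|ws T IH] i /=; first by rewrite nth_nil if_same.
rewrite filter_cat IH filter_row.
have [lt_ia | lt_ai | <-] := ltngtP i a => //=.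
  by rewrite -(subnSK lt_ia).
by rewrite subnn /= cats0.
Qed.

Lemma sorted_brick_row i c ws :
  sorted (fun t u => tcol t <= tcol u) (brick_row i c ws).
Proof.
case: ws => //= w ws; elim: ws c w => //= v ws IH c w.
by rewrite leq_addr IH.
Qed.

Lemma row_tiles_bricks T i :
  row_tiles (bricks 0 T) i = brick_row i 0 (nth [::] T i).
Proof.
rewrite /row_tiles filter_bricks subn0 sorted_sort ?sorted_brick_row //.
by move=> u t v; apply: leq_trans.
Qed.

Lemma bricks_tiling T : all (all (leq 1)) T ->
  is_brick_tiling [seq sumn row | row <- T] (bricks 0 T).
Proof.
move=> posT.
have brickP i : all (fun t => (theight t == 1) && (0 < twidth t)) (bricks i T).
  elim: T i posT => //= ws T IH i /andP[posw posT].
  rewrite all_cat IH // andbT.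
  move: posw; rewrite -(all_brick_row (leq 1) i 0); apply: sub_all => t.
  by rewrite -andbA => /andP[].
split; last by apply: sub_all (brickP 0) => t /andP[].
split=> [|[a b]|[a b]].
- by apply: sub_all (brickP 0) => t /andP[/eqP-> ->].
- by rewrite count_bricks leq_b1.
rewrite has_count count_bricks subn0 /in_diagram /= lt0b.
have [lt_aT | le_Ta] := ltnP a (size T); first by rewrite (nth_map [::]).
by rewrite !nth_default ?size_map.
Qed.

Lemma tableau_bricks T :
  tableau [seq sumn row | row <- T] (bricks 0 T) = T.
Proof.
rewrite /tableau size_map -[RHS](mkseq_nth [::]).
apply: eq_map => i; rewrite row_tiles_bricks.
by elim: (nth _ _ _) 0 => //= w ws IH c; rewrite IH.
Qed.

(** * Hook-shaped tableaux *)

Definition hook_tableau (x : nat) (arm leg : seq nat) : seq (seq nat) :=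
  (x :: arm) :: [seq [:: y] | y <- leg].

Lemma transpose_hook_tableau x arm leg :
  transpose (hook_tableau x arm leg) = hook_tableau x leg arm.
Proof.
rewrite /transpose /mkseq /=; congr ((_ :: _) :: _).
  by elim: leg => //= y leg ->.
rewrite (iotaDl 1 0) -map_comp -[in RHS](mkseq_nth 0 arm) -map_comp.
apply/eq_in_map => j; rewrite mem_iota add0n /= add1n ltnS => ->.
(* Below the corner row, no row reaches a column other than the first. *)
suff -> : [seq row <- [seq [:: y] | y <- leg] | j.+1 < size row] = [::] by [].
by elim: leg.
Qed.

Lemma hook_tableau_shape_partition x arm leg :
  is_partition (shape (hook_tableau x arm leg)).
Proof.
have -> : shape (hook_tableau x arm leg) = (size arm).+1 :: nseq (size leg) 1.
  by rewrite /shape /= -map_comp; congr (_ :: _); elim: leg => //= y leg ->.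
rewrite /is_partition /= all_nseq orbT andbT.
by elim: (size leg) (size arm) => //= n IH k; rewrite (IH 0).
Qed.

Lemma sumn_hook_tableau x arm leg :
  [seq sumn row | row <- hook_tableau x arm leg] = (x + sumn arm) :: leg.
Proof.
rewrite /= -map_comp; congr (_ :: _).
by elim: leg => //= y leg ->; rewrite addn0.
Qed.

Lemma hook_tableau_pos x arm leg :
  all (all (leq 1)) (hook_tableau x arm leg)
  = [&& 0 < x, all (leq 1) arm & all (leq 1) leg].
Proof.
rewrite /= all_map -andbA; congr [&& _, _ & _].
by apply: eq_all => y /=; rewrite andbT.
Qed.

(** * The tableau of a hook+column partition *)

Definition twos_ones (m n : nat) : seq nat := nseq m 2 ++ nseq n 1.

Lemma sumn_twos_ones m n : sumn (twos_ones m n) = 2 * m + n.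
Proof. by rewrite sumn_cat !sumn_nseq mul1n. Qed.

Lemma twos_ones_pos m n : all (leq 1) (twos_ones m n).
Proof. by rewrite all_cat !all_nseq !orbT. Qed.

Lemma hook_columnE r delta beta gamma :
  hook_column (r + 2 * delta + gamma) beta gamma
  = [seq sumn row
    | row <- hook_tableau r (twos_ones delta gamma) (twos_ones beta gamma)].
Proof. by rewrite sumn_hook_tableau sumn_twos_ones addnA. Qed.

Lemma hook_column_partition alpha beta gamma :
  2 <= alpha -> is_partition (hook_column alpha beta gamma).
Proof.
move=> alpha_ge2; rewrite /is_partition /= twos_ones_pos (ltnW alpha_ge2) !andbT.
have path1 k : 0 < k -> path geq k (nseq gamma 1).
  by elim: gamma k => //= n IH k k_gt0; rewrite k_gt0 IH.
elim: beta alpha alpha_ge2 => [|b IH] alpha alpha_ge2 /=.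
  by apply: path1; apply: ltnW.
by rewrite alpha_ge2 IH.
Qed.

(** A flip tiling is given by the tile shapes of its first row and the number
    of tiles of the others. This determines the tableau, since the only tile
    of a lower row must be as wide as the row. *)
Lemma flip_tiling_tableau r delta gamma l1 leg s :
  is_flip_tiling r delta gamma (l1 :: leg) s ->
  tableau (l1 :: leg) s = hook_tableau r (twos_ones delta gamma) leg.
Proof.
case=> bt row0 rows; rewrite /tableau /mkseq /=; congr (_ :: _).
  rewrite -[LHS]/(map (snd \o tshape) _) map_comp row0 /=.
  by rewrite map_cat !map_nseq.
rewrite (iotaDl 1 0) -map_comp -[in RHS](mkseq_nth 0 leg) -map_comp.
apply/eq_in_map => i; rewrite mem_iota add0n /= add1n => lt_i.
have := sumn_row_tiles i.+1 bt; have := rows i.+1 lt_i.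
by case: (row_tiles _ _) => [|t []] //= _; rewrite addn0 => ->.
Qed.

Lemma bricks_flip_tiling r delta beta gamma : 0 < r ->
  is_flip_tiling r delta gamma (hook_column (r + 2 * delta + gamma) beta gamma)
    (bricks 0 (hook_tableau r (twos_ones delta gamma) (twos_ones beta gamma))).
Proof.
move=> r_gt0; rewrite hook_columnE; split.
- by apply: bricks_tiling; rewrite hook_tableau_pos r_gt0 !twos_ones_pos.
- rewrite row_tiles_bricks /=; congr (_ :: _).
  transitivity [seq (1, w) | w <- twos_ones delta gamma].
    by move: (0 + r); elim: twos_ones => //= w ws IH c; rewrite IH.
  by rewrite map_cat !map_nseq.
move=> [|i] //; rewrite row_tiles_bricks sumn_hook_tableau /= => lt_i.
by rewrite (nth_map 0).
Qed.

Theorem mainTheorem4 (lambda : seq nat) (lambda1 beta gamma r delta : nat)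
    (hpart : is_partition lambda)
    (hlambda : lambda = hook_column lambda1 beta gamma)
    (hr : 2 <= r)
    (hdelta : lambda1 = r + gamma + 2 * delta) :
  (exists s : seq tile, is_flip_tiling r delta gamma lambda s) /\
  (forall s : seq tile, is_flip_tiling r delta gamma lambda s ->
     forall mu : seq nat,
       (exists s' : seq tile, is_tiled_transpose lambda s mu s')
       <-> mu = flip r lambda).
Proof.
have r_gt0 : 0 < r by apply: ltnW.
rewrite addnAC in hdelta; rewrite {}hdelta in hlambda.
split.
  by rewrite hlambda; eexists; apply: bricks_flip_tiling.
move=> s flip_s mu.
have bt_s : is_brick_tiling lambda s by case: flip_s.
have tab_s : tableau lambda s
    = hook_tableau r (twos_ones delta gamma) (twos_ones beta gamma).
  by move: flip_s; rewrite hlambda; apply: flip_tiling_tableau.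
rewrite hlambda flipE -hlambda; split.
  case=> s' [_ _ [_ bt_s'] tab_s'].
  rewrite -(sumn_tableau bt_s') tab_s' tab_s transpose_hook_tableau.
  by rewrite -hook_columnE.
move=> ->.
exists (bricks 0
  (hook_tableau r (twos_ones beta gamma) (twos_ones delta gamma))).
split.
- by [].
- by rewrite tab_s hook_tableau_shape_partition.
- split; last by case: (bricks_flip_tiling beta delta gamma r_gt0).
  by apply: hook_column_partition; rewrite -addnA ltn_addr.
by rewrite hook_columnE tableau_bricks tab_s transpose_hook_tableau.
Qed.
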